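(* Let $F=(F_1,\dots,F_m):\mathbb{R}^n\to\mathbb{R}^m$ be twice continuously differentiable. Let $\{x_k\}$ be an infinite sequence of points, none of which is Pareto critical, produced by the variable metric method with BFGS updates (VMM-BFGS) with line search parameters $\sigma,\gamma\in(0,1)$, with associated $B_k$, $\lambda^k$, $d_k$, $\alpha_k$, and assume that $$\lim_{k\to\infty}\frac{\big\|\big(B_k-\sum_{i=1}^m\lambda_i^k\nabla^2F_i(x_k)\big)d_k\big\|}{\|d_k\|}=0 .$$ Suppose $V\subset\mathbb{R}^n$, $k_0\in\mathbb{N}$, $a,b,r,\delta,\epsilon>0$ and (a) $aI\leqslant B_k\leqslant bI$ for all $k$; (b) $\|\nabla^2F_i(x)-\nabla^2F_i(y)\|<\frac{\epsilon}{2}$ for all $x,y\in V$ with $\|x-y\|<\delta$ and all $i=1,\dots,m$; (c) $\big\|\big(\sum_{i=1}^m\lambda_i^k\nabla^2F_i(x_k)-B_k\big)(y-x_k)\big\|<\frac{\epsilon}{2}\|y-x_k\|$ for all $k\geqslant k_0$ and all $y\in V$ with $y\neq x_k$; (d) $\frac{\epsilon}{a}\leqslant 1-\sigma$; (e) $\mathbf{B}[x_{k_0},r]\subset V$; (f) $\|d_{k_0}\|\leqslant\min\{\delta,\ r(1-\frac{\epsilon}{a})\}$. Then, for all $k\geqslant k_0$: (i) $\|x_k-x_{k_0}\|\leqslant\dfrac{1-(\epsilon/a)^{k-k_0}}{1-\epsilon/a}\,\|d_{k_0}\|$; (ii) $\|d_k\|\leqslant(\epsilon/a)^{k-k_0}\|d_{k_0}\|$;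 (iii) $\alpha_k=1$; (iv) $\|d_{k+1}\|\leqslant\frac{\epsilon}{a}\|d_k\|$. Moreover, the sequence $\{x_k\}$ converges to some Pareto critical point $x^*\in\mathbb{R}^n$ with $$\lim_{k\to\infty}\frac{\|x_{k+1}-x^*\|}{\|x_k-x^*\|}=0,$$ i.e. the convergence rate of $\{x_k\}$ is superlinear.
   Context: $\mathbf{B}[x,r]$ is the closed Euclidean ball with center $x$ and radius $r$. For symmetric matrices, $A\leqslant B$ means $B-A$ is positive semidefinite. $\nabla F_i$, $\nabla^2F_i$ are the gradient and Hessian of $F_i$. $\Delta_m=\{\lambda\in\mathbb{R}^m:\sum_{i=1}^m\lambda_i=1,\ \lambda_i\geqslant 0\ \text{for all } i\}$. A point $x^*\in\mathbb{R}^n$ is Pareto critical for $F$ if there is no $d\in\mathbb{R}^n$ with $\nabla F_i(x^* )^{\mathrm T}d<0$ for all $i=1,\dots,m$. VMM-BFGS: start from $x_0\in\mathbb{R}^n$ and $B_0=I$. At iteration $k$ choose $$\lambda^k\in\arg\min_{\lambda\in\Delta_m}\tfrac12\Big(\sum_{i=1}^m\lambda_i\nabla F_i(x_k)\Big)^{\mathrm T}B_k^{-1}\Big(\sum_{i=1}^m\lambda_i\nabla F_i(x_k)\Big),$$ $$d_k=-B_k^{-1}\sum_{i=1}^m\lambda_i^k\nabla F_i(x_k),\qquad \theta_k=-\tfrac12 d_k^{\mathrm T}B_kd_k=\tfrac12 d_k^{\mathrm T}\sum_{i=1}^m\lambda_i^k\nabla F_i(x_k).$$ Let $\alpha_k$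 be the first element of $1,\gamma,\gamma^2,\dots$ such that $$\sum_{i=1}^m\lambda_i^kF_i(x_k+\alpha_kd_k)-\sum_{i=1}^m\lambda_i^kF_i(x_k)\leqslant\sigma\alpha_k\theta_k$$ (aggregated Armijo line search), and set $x_{k+1}=x_k+\alpha_kd_k$. With $s_k=x_{k+1}-x_k$ and $y_k=\sum_{i=1}^m\lambda_i^k(\nabla F_i(x_{k+1})-\nabla F_i(x_k))$, set $$B_{k+1}=B_k-\frac{B_ks_ks_k^{\mathrm T}B_k}{s_k^{\mathrm T}B_ks_k}+\frac{y_ky_k^{\mathrm T}}{s_k^{\mathrm T}y_k}\ \text{ if } s_k^{\mathrm T}y_k>0,\qquad B_{k+1}=B_k\ \text{ otherwise.}$$ (The algorithm stops only if $|\theta_k|$ is at most a given tolerance; it is assumed that it does not stop.) *)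

(* Defs.v *)
(* MathComp / MathComp-Analysis *)
From mathcomp Require Import all_boot all_order all_algebra.
From mathcomp Require Import all_classical all_reals all_analysis.

Set Implicit Arguments.
Unset Strict Implicit.
Unset Printing Implicit Defensive.

Import Order.TTheory GRing.Theory Num.Theory.
Import numFieldNormedType.Exports.

Local Open Scope classical_set_scope.
Local Open Scope ring_scope.

Definition dotv {R : realType} {n : nat} (u v : 'cV[R]_n) : R :=
  (u^T *m v) 0 0.

(* The library norm `|v| on matrices is the sup norm; it induces the same
   topology and the same notion of differentiability as this one. *)
Definition enorm {R : realType} {n : nat} (v : 'cV[R]_n) : R :=
  Num.sqrt (dotv v v).

Definition opnorm {R : realType} {n : nat} (A : 'M[R]_n) : R :=
  sup [set enorm (A *m v) | v in [set v : 'cV[R]_n | enorm v <= 1]].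

Definition psdmx {R : realType} {n : nat} (A : 'M[R]_n) : Prop :=
  A^T = A /\ forall v : 'cV[R]_n, 0 <= dotv v (A *m v).

Definition loewner_le {R : realType} {n : nat} (A B : 'M[R]_n) : Prop :=
  psdmx (B - A).

Definition gradient {R : realType} {n : nat} (f : 'cV[R]_n -> R)
    (x : 'cV[R]_n) : 'cV[R]_n :=
  \col_i 'D_(delta_mx i 0) f x.

Definition hessian {R : realType} {n : nat} (f : 'cV[R]_n -> R)
    (x : 'cV[R]_n) : 'M[R]_n :=
  \matrix_(i, j) 'D_(delta_mx j 0) ('D_(delta_mx i 0) f) x.

(* 'D_v f is a total operator, so existence of the derivatives has to be
   required separately from the continuity of the Hessian. *)
Definition twice_continuously_differentiable {R : realType} {n : nat}
    (f : 'cV[R]_n -> R) : Prop :=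
  [/\ forall x, differentiable f x,
      forall x, differentiable (gradient f) x
    & continuous (hessian f)].

Definition pareto_critical {R : realType} {m n : nat}
    (F : 'I_m -> 'cV[R]_n -> R) (x : 'cV[R]_n) : Prop :=
  ~ exists d : 'cV[R]_n, forall i, dotv (gradient (F i) x) d < 0.

Definition simplex {R : realType} (m : nat) : set 'cV[R]_m :=
  [set l | \sum_i l i 0 = 1 /\ forall i, 0 <= l i 0].

Definition agg {R : realType} {m n : nat} (F : 'I_m -> 'cV[R]_n -> R)
    (l : 'cV[R]_m) (x : 'cV[R]_n) : R :=
  \sum_i l i 0 * F i x.

Definition agg_gradient {R : realType} {m n : nat}
    (F : 'I_m -> 'cV[R]_n -> R) (l : 'cV[R]_m) (x : 'cV[R]_n) : 'cV[R]_n :=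
  \sum_i l i 0 *: gradient (F i) x.

Definition agg_hessian {R : realType} {m n : nat}
    (F : 'I_m -> 'cV[R]_n -> R) (l : 'cV[R]_m) (x : 'cV[R]_n) : 'M[R]_n :=
  \sum_i l i 0 *: hessian (F i) x.

Definition dual_objective {R : realType} {m n : nat}
    (F : 'I_m -> 'cV[R]_n -> R) (B : 'M[R]_n) (x : 'cV[R]_n)
    (l : 'cV[R]_m) : R :=
  2^-1 * dotv (agg_gradient F l x) (invmx B *m agg_gradient F l x).

Definition theta {R : realType} {n : nat} (B : 'M[R]_n) (d : 'cV[R]_n) : R :=
  - (2^-1 * dotv d (B *m d)).

Definition armijo {R : realType} {m n : nat} (F : 'I_m -> 'cV[R]_n -> R)
    (sigma : R) (B : 'M[R]_n) (l : 'cV[R]_m) (x d : 'cV[R]_n)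
    (alpha : R) : Prop :=
  agg F l (x + alpha *: d) - agg F l x <= sigma * alpha * theta B d.

Definition bfgs_update {R : realType} {n : nat} (B : 'M[R]_n)
    (s y : 'cV[R]_n) : 'M[R]_n :=
  if 0 < dotv s y then
    B - (dotv s (B *m s))^-1 *: (B *m s *m s^T *m B)
      + (dotv s y)^-1 *: (y *m y^T)
  else B.

(* The minimizer lam k need not be unique; any choice is allowed.  The run is
   infinite, so the stopping test does not appear. *)
Record vmm_bfgs {R : realType} {m n : nat} (F : 'I_m -> 'cV[R]_n -> R)
    (sigma gamma : R) (x : nat -> 'cV[R]_n) (B : nat -> 'M[R]_n)
    (lam : nat -> 'cV[R]_m) (d : nat -> 'cV[R]_n) (alpha : nat -> R) : Prop :=
  VmmBfgs {
    vmm_init : B 0%N = 1%:M;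
    vmm_lam : forall k, simplex (lam k) /\
      forall mu, simplex mu ->
        dual_objective F (B k) (x k) (lam k) <= dual_objective F (B k) (x k) mu;
    vmm_dir : forall k, d k = - (invmx (B k) *m agg_gradient F (lam k) (x k));
    vmm_step : forall k, exists j : nat,
      [/\ alpha k = gamma ^+ j,
          armijo F sigma (B k) (lam k) (x k) (d k) (gamma ^+ j)
        & forall i : nat, (i < j)%N ->
            ~ armijo F sigma (B k) (lam k) (x k) (d k) (gamma ^+ i)];
    vmm_next : forall k, x k.+1 = x k + alpha k *: d k;
    vmm_update : forall k, B k.+1 =
      bfgs_update (B k) (x k.+1 - x k)
        (\sum_i lam k i 0 *:
           (gradient (F i) (x k.+1) - gradient (F i) (x k)))
  }.

(* Main.v *)
(* Since lam k is feasible in the dual problem of iteration k+1, and both B k.+1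
   and its inverse are controlled by a, one has
   a ‖d k.+1‖ <= ‖g‖ with g the lam k-aggregated gradient at x k.+1.  As
   B k *m d k is minus that gradient at x k, after a unit step the mean value
   theorem bounds ‖g‖ by ‖(B k - H k) d k‖ plus the variation of the Hessians
   along the step.  Conditions (b), (c) make this at most eps ‖d k‖, whence the
   contraction (iv); a second-order Taylor bound under the same conditions gives
   the Armijo inequality for the unit step.  Near the limit point the continuity
   of the Hessians and the Dennis-More condition replace eps by an arbitrary
   positive number, which yields superlinear convergence. *)
Require Import Defs.
From mathcomp Require Import all_boot all_order all_algebra.
From mathcomp Require Import all_classical all_reals all_analysis.
From mathcomp Require Import ring lra.
Set Implicit Arguments.
Unset Strict Implicit.
Unset Printing Implicit Defensive.
Import Order.TTheory GRing.Theory Num.Theory.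
Import numFieldNormedType.Exports.
Local Open Scope classical_set_scope.
Local Open Scope ring_scope.

(** * Euclidean norm, matrix action and Loewner bounds *)

Section Euclid.
Context {R : realType} {n : nat}.
Implicit Types (u v w p : 'cV[R]_n) (A B : 'M[R]_n) (a b c t : R).

Lemma dotvE u v : dotv u v = \sum_i u i 0 * v i 0.
Proof. by rewrite /dotv mxE; apply: eq_bigr => i _; rewrite mxE. Qed.

Lemma dotvC u v : dotv u v = dotv v u.
Proof. by rewrite !dotvE; apply: eq_bigr => i _; rewrite mulrC. Qed.

Lemma dotvDr u v w : dotv u (v + w) = dotv u v + dotv u w.
Proof. by rewrite /dotv mulmxDr mxE. Qed.

Lemma dotvZr c u v : dotv u (c *: v) = c * dotv u v.
Proof. by rewrite /dotv -scalemxAr mxE. Qed.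

Lemma dotvNr u v : dotv u (- v) = - dotv u v.
Proof. by rewrite /dotv mulmxN mxE. Qed.

Lemma dotvBr u v w : dotv u (v - w) = dotv u v - dotv u w.
Proof. by rewrite dotvDr dotvNr. Qed.

Lemma dotvDl u v w : dotv (v + w) u = dotv v u + dotv w u.
Proof. by rewrite ![dotv _ u]dotvC dotvDr. Qed.

Lemma dotvZl c u v : dotv (c *: v) u = c * dotv v u.
Proof. by rewrite ![dotv _ u]dotvC dotvZr. Qed.

Lemma dotvNl u v : dotv (- v) u = - dotv v u.
Proof. by rewrite ![dotv _ u]dotvC dotvNr. Qed.

Lemma dotv_sumr u (I : finType) (f : I -> 'cV[R]_n) :
  dotv u (\sum_i f i) = \sum_i dotv u (f i).
Proof. by rewrite /dotv mulmx_sumr summxE. Qed.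

Lemma dotvv_ge0 v : 0 <= dotv v v.
Proof. by rewrite dotvE; apply: sumr_ge0 => i _; rewrite -expr2 sqr_ge0. Qed.

Lemma enorm_ge0 v : 0 <= enorm v.
Proof. exact: sqrtr_ge0. Qed.
#[local] Hint Resolve enorm_ge0 : core.

Lemma sqr_enorm v : enorm v ^+ 2 = dotv v v.
Proof. by rewrite sqr_sqrtr// dotvv_ge0. Qed.

Lemma enorm0 : enorm (0 : 'cV[R]_n) = 0.
Proof. by rewrite /enorm /dotv mulmx0 mxE sqrtr0. Qed.

Lemma coord_le_enorm v i : `|v i 0| <= enorm v.
Proof.
rewrite -sqrtr_sqr ler_wsqrtr// dotvE (bigD1 i)//= expr2 lerDl.
by apply: sumr_ge0 => j _; rewrite -expr2 sqr_ge0.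
Qed.

Lemma enorm_le0 v : enorm v <= 0 -> v = 0.
Proof.
move=> v0; apply/colP => i; rewrite mxE; apply/eqP; rewrite -normr_eq0 eq_le.
by rewrite normr_ge0 (le_trans (coord_le_enorm v i)).
Qed.

Lemma enorm_gt0 v : v != 0 -> 0 < enorm v.
Proof. by move=> v0; rewrite ltNge; apply: contra v0 => /enorm_le0 ->. Qed.

Lemma enormZ c v : enorm (c *: v) = `|c| * enorm v.
Proof.
by rewrite /enorm dotvZr dotvZl mulrA -expr2 sqrtrM ?sqr_ge0// sqrtr_sqr.
Qed.

Lemma enormN v : enorm (- v) = enorm v.
Proof. by rewrite /enorm dotvNr dotvNl opprK. Qed.

Lemma enormB u v : enorm (u - v) = enorm (v - u).
Proof. by rewrite -enormN opprB. Qed.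

(* Nonnegativity of the quadratic [t |-> q(u + t v)] at its vertex. *)
Lemma psdmx_CauchySchwarz B u v : psdmx B ->
  dotv u (B *m v) ^+ 2 <= dotv u (B *m u) * dotv v (B *m v).
Proof.
move=> [Bsym Bpos].
have sym : dotv v (B *m u) = dotv u (B *m v).
  by rewrite [RHS]dotvC /dotv trmx_mul Bsym mulmxA.
have key (p q : R) : 0 <= p ^+ 2 * dotv u (B *m u) + 2 * p * q * dotv u (B *m v)
                  + q ^+ 2 * dotv v (B *m v).
  have := Bpos (p *: u + q *: v).
  rewrite mulmxDr -!scalemxAr !dotvDr !dotvDl !dotvZr !dotvZl sym.
  by congr (_ <= _); ring.
have u0 := Bpos u; have v0 := Bpos v.
set a := dotv u (B *m u) in key u0 *; set b := dotv u (B *m v) in key *.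
set c := dotv v (B *m v) in key v0 *.
have [c0|c0] := ltP 0 c.
  have := key c (- b).
  have -> : c ^+ 2 * a + 2 * c * - b * b + (- b) ^+ 2 * c = c * (a * c - b ^+ 2).
    by ring.
  by rewrite pmulr_rge0// subr_ge0.
have {}c0 : c = 0 by apply/eqP; rewrite eq_le c0.
have [a0|a0] := ltP 0 a.
  have := key (- b) a; rewrite c0 !mulr0 addr0.
  have -> : (- b) ^+ 2 * a + 2 * - b * a * b = a * - b ^+ 2 by ring.
  by rewrite pmulr_rge0// oppr_ge0.
have {}a0 : a = 0 by apply/eqP; rewrite eq_le a0.
have := key (- b) 1; rewrite a0 c0 !mulr0 addr0 add0r.
have := sqr_ge0 b; nra.
Qed.

Lemma psdmx1 : psdmx (1%:M : 'M[R]_n).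
Proof. by split=> [|v]; rewrite ?trmx1// mul1mx dotvv_ge0. Qed.

Lemma dotv_le_enorm u v : dotv u v <= enorm u * enorm v.
Proof.
apply: le_trans (ler_norm _) _.
rewrite -ler_sqr ?nnegrE ?mulr_ge0// exprMn !sqr_enorm real_normK ?num_real//.
by have := psdmx_CauchySchwarz u v psdmx1; rewrite !mul1mx.
Qed.

Lemma enormD u v : enorm (u + v) <= enorm u + enorm v.
Proof.
rewrite -ler_sqr ?nnegrE ?addr_ge0// sqrrD !sqr_enorm dotvDr !dotvDl (dotvC v u).
have := dotv_le_enorm u v; nra.
Qed.

Lemma enorm_triangle u v w : enorm (u - w) <= enorm (u - v) + enorm (v - w).
Proof. by rewrite (le_trans _ (enormD _ _))// addrA subrK. Qed.

(** Convexity of the distance to [p]; it keeps the segment of a step inside any ball that contains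
    both of its ends. *)
Lemma enorm_segment_le t u v p : 0 <= t <= 1 ->
  enorm (u + t *: v - p) <= (1 - t) * enorm (u - p) + t * enorm (u + v - p).
Proof.
move=> /andP[t0 t1].
have -> : u + t *: v - p = (1 - t) *: (u - p) + t *: (u + v - p).
  by rewrite addrAC [u + v - p]addrAC [t *: (_ + v)]scalerDr addrA -scalerDl
    subrK scale1r.
by rewrite (le_trans (enormD _ _))// !enormZ !ger0_norm// subr_ge0.
Qed.

Lemma enorm_le_sum v : enorm v <= \sum_i `|v i 0|.
Proof.
rewrite -ler_sqr ?nnegrE ?sumr_ge0// sqr_enorm dotvE expr2 big_distrl/=.
apply: ler_sum => i _; apply: le_trans (ler_norm _) _.
rewrite normrM ler_wpM2l// (bigD1 i)//= lerDl.
exact: sumr_ge0.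
Qed.

Lemma enorm_simplex_sum {m} (l : 'cV[R]_m) (f : 'I_m -> 'cV[R]_n) c :
  simplex l -> (forall i, enorm (f i) <= c) ->
  enorm (\sum_i l i 0 *: f i) <= c.
Proof.
move=> [l1 l0] fc.
have -> : c = \sum_i l i 0 * c by rewrite -big_distrl /= l1 mul1r.
elim/big_ind2: _ => [|p q s t pq st|i _]; first by rewrite enorm0.
  exact: le_trans (enormD _ _) (lerD pq st).
by rewrite enormZ ger0_norm// ler_wpM2l.
Qed.

(** A crude entrywise bound: it makes the supremum in [opnorm] finite and links the matrix action to
    the library norm. *)
Lemma enorm_mulmx_le A v : enorm (A *m v) <= (\sum_i \sum_j `|A i j|) * enorm v.
Proof.
apply: le_trans (enorm_le_sum _) _; rewrite big_distrl/=.
apply: ler_sum => i _; rewrite mxE (le_trans (ler_norm_sum _ _ _))//.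
rewrite big_distrl/=; apply: ler_sum => j _.
by rewrite normrM ler_wpM2l// coord_le_enorm.
Qed.

Lemma enorm_mulmx_opnorm A v : enorm (A *m v) <= opnorm A * enorm v.
Proof.
have [->|v0] := eqVneq v 0; first by rewrite mulmx0 enorm0 mulr0.
have nv := enorm_gt0 v0.
rewrite -ler_pdivrMr//.
have -> : enorm (A *m v) / enorm v = enorm (A *m ((enorm v)^-1 *: v)).
  by rewrite -scalemxAr enormZ mulrC ger0_norm// invr_ge0.
apply: ub_le_sup; last first.
  exists ((enorm v)^-1 *: v) => //=.
  by rewrite enormZ ger0_norm ?invr_ge0// mulVf ?gt_eqF.
(* [sup] dominates the elements only of a bounded set; the sum of the absolute entries bounds the
   image of the unit ball. *)
exists (\sum_i \sum_j `|A i j|) => _ [w /= w1 <-].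
apply: le_trans (enorm_mulmx_le _ _) _; rewrite ler_piMr//.
by do 2!apply: sumr_ge0 => ? _.
Qed.

Lemma loewner_le_scalar_l a B v : loewner_le a%:M B ->
  a * enorm v ^+ 2 <= dotv v (B *m v).
Proof.
by move=> [_ /(_ v)]; rewrite mulmxBl dotvBr mul_scalar_mx dotvZr sqr_enorm subr_ge0.
Qed.

Lemma loewner_le_scalar_r b B v : loewner_le B b%:M ->
  dotv v (B *m v) <= b * enorm v ^+ 2.
Proof.
by move=> [_ /(_ v)]; rewrite mulmxBl dotvBr mul_scalar_mx dotvZr sqr_enorm subr_ge0.
Qed.

Lemma loewner_psdmx a B : 0 <= a -> loewner_le a%:M B -> psdmx B.
Proof.
move=> a0 aB; split=> [|v]; last first.
  by apply: le_trans (loewner_le_scalar_l v aB); rewrite mulr_ge0// sqr_ge0.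
have [sym _] := aB; have := sym; rewrite linearB/= tr_scalar_mx.
exact: addIr.
Qed.

(** Cauchy-Schwarz for the form [B] at [B v] and [v] gives [|Bv|^4 <= (b |Bv|^2) (b |v|^2)]; cancel
    [|Bv|^2]. *)
Lemma loewner_enorm_mulmx_le b B v : 0 <= b -> psdmx B -> loewner_le B b%:M ->
  enorm (B *m v) <= b * enorm v.
Proof.
move=> b0 Bpsd Bb; have := psdmx_CauchySchwarz (B *m v) v Bpsd.
rewrite -sqr_enorm.
have := loewner_le_scalar_r v Bb; have := loewner_le_scalar_r (B *m v) Bb.
have [_ Bpos] := Bpsd; have := Bpos v; have := Bpos (B *m v).
set P := dotv _ _; set Q := dotv _ _ => P0 Q0 PB QB PQ.
have [/enorm_le0 ->|w0] := leP (enorm (B *m v)) 0.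
  by rewrite enorm0 mulr_ge0.
rewrite -ler_sqr ?nnegrE ?mulr_ge0// -(ler_pM2l (exprn_gt0 2 w0)) -expr2.
apply: le_trans PQ _; apply: le_trans (ler_pM P0 Q0 PB QB) _.
by rewrite mulrACA -expr2 mulrCA exprMn lexx.
Qed.

(** By symmetry a row [u] of the left kernel satisfies [B u^T = 0], and coercivity then forces
    [u = 0]. *)
Lemma loewner_unitmx a B : 0 < a -> loewner_le a%:M B -> B \in unitmx.
Proof.
move=> a0 aB; have [Bsym _] := loewner_psdmx (ltW a0) aB.
rewrite -row_free_unit -kermx_eq0; apply/eqP/row_matrixP => i; rewrite row0.
set u := row i _; have uB : u *m B = 0.
  by rewrite /u -row_mul mulmx_ker row0.
apply: trmx_inj; rewrite trmx0; apply: enorm_le0.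
have := loewner_le_scalar_l u^T aB.
have -> : B *m u^T = 0 by rewrite -Bsym -trmx_mul uB trmx0.
rewrite /dotv mulmx0 mxE pmulr_rle0//.
by have := enorm_ge0 u^T; nra.
Qed.

(** With [v = B^-1 g], coercivity reads [a |v|^2 <= g.v <= |g| |v|], so [|v| <= |g| / a], and
    Cauchy-Schwarz concludes. *)
Lemma invmx_form_le a B g : 0 < a -> loewner_le a%:M B ->
  dotv g (invmx B *m g) <= enorm g ^+ 2 / a.
Proof.
move=> a0 aB; set v := invmx B *m g.
have gE : B *m v = g by rewrite mulKVmx// (loewner_unitmx a0 aB).
have := loewner_le_scalar_l v aB; rewrite gE dotvC => h1.
have h2 := dotv_le_enorm g v.
have := enorm_ge0 v; have := enorm_ge0 g.
rewrite ler_pdivlMr// => g0 v0.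
have : a * enorm v <= enorm g.
  have [/enorm_le0 ->|vp] := leP (enorm v) 0; first by rewrite enorm0 mulr0.
  by rewrite -(ler_pM2r vp) -mulrA -expr2 (le_trans h1).
nra.
Qed.

End Euclid.
#[local] Hint Resolve enorm_ge0 : core.

(** * Derivatives along lines, mean value and second-order Taylor bounds *)

Section Calculus.
Context {R : realType} {n : nat}.
Implicit Types (f : 'cV[R]_n -> R) (x d p w : 'cV[R]_n) (A : 'M[R]_n) (c : R).

Lemma derive_gradient f p d : differentiable f p ->
  'D_d f p = dotv (gradient f p) d.
Proof.
move=> fp; rewrite deriveE// [d in LHS]matrix_sum_delta.
rewrite linear_sum dotvE; apply: eq_bigr => i _ /=.
by rewrite big_ord1 linearZ/= mxE deriveE// mulrC.
Qed.

Lemma is_derive_line f x d t : differentiable f (x + t *: d) ->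
  is_derive t 1 (fun s : R => f (x + s *: d)) (dotv (gradient f (x + t *: d)) d).
Proof.
move=> fp; rewrite -derive_gradient//.
have eqd : (fun h : R =>
    h^-1 *: ((fun s : R => f (x + s *: d)) (h *: 1 + t) - f (x + t *: d)))
  = (fun h : R => h^-1 *: (f (h *: d + (x + t *: d)) - f (x + t *: d))).
  by apply/funext => h; rewrite /= [h *: 1]mulr1 scalerDl addrCA.
have dfp : derivable f (x + t *: d) d by exact: diff_derivable.
by split; [rewrite /derivable eqd|rewrite /derive eqd].
Qed.

Lemma differentiable_partial f p i : differentiable (gradient f) p ->
  differentiable ('D_(delta_mx i 0) f) p.
Proof.
move=> gp.
have -> : 'D_(delta_mx i 0) f = (fun M : 'cV[R]_n => M i 0) \o gradient f.
  by apply/funext => q; rewrite /= mxE.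
exact/differentiable_comp/differentiable_coord.
Qed.

Lemma gradient_partial f p d i :
  dotv (gradient ('D_(delta_mx i 0) f) p) d = (hessian f p *m d) i 0.
Proof. by rewrite dotvE mxE; apply: eq_bigr => j _; rewrite !mxE. Qed.

(** The scalar product with [w] is a fixed combination of partial derivatives, each of which is a
    differentiable scalar function restricted to a line. *)
Lemma is_derive_gradient_line f x d w t :
  differentiable (gradient f) (x + t *: d) ->
  is_derive t 1 (fun s : R => dotv w (gradient f (x + s *: d)))
    (dotv w (hessian f (x + t *: d) *m d)).
Proof.
move=> gp.
have -> : (fun s : R => dotv w (gradient f (x + s *: d))) =
  \sum_i (w i 0 \*: (fun s : R => 'D_(delta_mx i 0) f (x + s *: d))).
  apply/funext => s; rewrite fct_sumE dotvE.
  by apply: eq_bigr => i _; rewrite !mxE.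
rewrite dotvE; apply: is_derive_sum => i.
apply: is_deriveZ; rewrite -gradient_partial.
exact/is_derive_line/differentiable_partial.
Qed.

Lemma MVT01 (phi dphi : R -> R) : (forall t : R, is_derive t 1 phi (dphi t)) ->
  exists2 t, 0 < t < 1 & phi 1 - phi 0 = dphi t.
Proof.
move=> h; have [|t t01 ->] := @MVT R phi dphi 0 1 ltr01 (fun t _ => h t).
  apply/continuous_subspaceT => t.
  by apply/differentiable_continuous/derivable1_diffP; have [] := h t.
by exists t; rewrite ?subr0 ?mulr1//; move: t01; rewrite in_itv.
Qed.

(* The mean value theorem fails for vector-valued maps; it is applied to the
   scalar product with the error vector [w] itself. *)
Lemma gradient_mean_value f x d A c :
  (forall y, differentiable (gradient f) y) ->
  (forall t, 0 < t < 1 -> enorm ((hessian f (x + t *: d) - A) *m d) <= c) ->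
  enorm (gradient f (x + d) - gradient f x - A *m d) <= c.
Proof.
move=> gdiff hc; set w := _ - _ - _.
pose phi (t : R) := dotv w (gradient f (x + t *: d)) - dotv w (A *m d) * t.
have dphi (t : R) : is_derive t 1 phi
    (dotv w (hessian f (x + t *: d) *m d) - dotv w (A *m d)).
  apply: is_deriveB; first exact: is_derive_gradient_line.
  by apply: is_derive_eq; rewrite [_ *: 1]mulr1.
have [t t01] := MVT01 dphi.
rewrite /phi scale1r scale0r addr0 mulr1 mulr0 subr0 addrAC -!dotvBr -mulmxBl.
rewrite -/w -sqr_enorm => ww.
have := dotv_le_enorm w ((hessian f (x + t *: d) - A) *m d); rewrite -ww.
have := hc t t01; have := enorm_ge0 w.
have [/enorm_le0 ->|w0] := leP (enorm w) 0.
  by move=> _ cge _; rewrite enorm0; apply: le_trans cge; exact: enorm_ge0.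
by move=> _ cge; rewrite expr2 ler_pM2l// => /le_trans ->.
Qed.

(** Subtracting the quadratic model from [f] along the segment leaves [psi], whose derivative is
    nonpositive on the open unit interval. *)
Lemma taylor2_le f x d A c :
  (forall y, differentiable f y) -> (forall y, differentiable (gradient f) y) ->
  (forall t, 0 < t < 1 -> enorm ((hessian f (x + t *: d) - A) *m d) <= c) ->
  f (x + d) - f x <= dotv (gradient f x) d
    + 2^-1 * (dotv d (A *m d) + c * enorm d).
Proof.
move=> fdiff gdiff hc.
set g := dotv (gradient f x) d; set q := dotv d (A *m d) + c * enorm d.
pose psi (t : R) := f (x + t *: d) - (g * t + 2^-1 * q * t ^+ 2).
have dpsi (t : R) : is_derive t 1 psi
    (dotv (gradient f (x + t *: d)) d - (g + q * t)).
  apply: is_deriveB; first exact: is_derive_line.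
  apply: is_derive_eq; rewrite /GRing.scale/= !mulr1; congr (_ + _).
  by field.
have [t /andP[t0 t1]] := MVT01 dpsi.
rewrite /psi scale1r scale0r addr0 expr1n expr0n/= !mulr1 !mulr0 addr0 subr0.
suff : dotv (gradient f (x + t *: d)) d - (g + q * t) <= 0 by lra.
(* The mean value bound on the shorter step [t *: d]: its points stay on the original segment, and
   the vector acted upon contributes the factor [t]. *)
have tc : enorm (gradient f (x + t *: d) - gradient f x - A *m (t *: d)) <= t * c.
  apply: gradient_mean_value => // s /andP[s0 s1].
  rewrite scalerA -scalemxAr enormZ gtr0_norm// ler_wpM2l ?(ltW t0)//.
  by apply: hc; rewrite mulr_gt0// mulr_ilt1 ?ltW.
have := dotv_le_enorm d (gradient f (x + t *: d) - gradient f x - A *m (t *: d)).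
rewrite !dotvBr -scalemxAr dotvZr ![dotv d (gradient _ _)]dotvC -/g /q.
have := ler_wpM2l (enorm_ge0 d) tc; rewrite -scalemxAr; nra.
Qed.

End Calculus.

(** * Comparison of the Euclidean norm with the library topology *)

Section Topology.
Context {R : realType} {n : nat}.
Implicit Types (p v y : 'cV[R]_n) (A : 'M[R]_n).

Lemma coord_le_mx_norm {m k} (M : 'M[R]_(m, k)) i j : `|M i j| <= `|M|.
Proof.
rewrite [leRHS]/Num.Def.normr/= mx_normrE.
exact: (le_bigmax _ (fun ij : 'I_m * 'I_k => `|M ij.1 ij.2|) (i, j)).
Qed.

Lemma mx_norm_le_enorm v : `|v| <= enorm v.
Proof.
rewrite [leLHS]/Num.Def.normr/= mx_normrE.
apply/bigmax_leP; split=> [|[i j] _ /=]; first exact: enorm_ge0.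
by rewrite ord1 coord_le_enorm.
Qed.

Lemma enorm_le_mx_norm v : enorm v <= n%:R * `|v|.
Proof.
apply: le_trans (enorm_le_sum v) _.
apply: le_trans (ler_sum _ (fun i _ => coord_le_mx_norm v i 0)) _.
by rewrite sumr_const card_ord mulr_natl.
Qed.

Lemma enorm_mulmx_mx_norm A v : enorm (A *m v) <= n%:R * (n%:R * `|A|) * enorm v.
Proof.
apply: le_trans (enorm_mulmx_le A v) _; rewrite ler_wpM2r ?enorm_ge0//.
apply: (@le_trans _ _ (\sum_(i < n) \sum_(j < n) `|A|)); last first.
  by rewrite !sumr_const !card_ord !mulr_natl.
by apply: ler_sum => i _; apply: ler_sum => j _; exact: coord_le_mx_norm.
Qed.

Lemma nbhs_enorm p (P : set 'cV[R]_n) : nbhs p P ->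
  exists2 e, 0 < e & forall y, enorm (y - p) < e -> P y.
Proof.
move=> /nbhs_ballP[e /= e0 eP]; exists e => // y ye; apply: eP.
by rewrite -ball_normE/= distrC (le_lt_trans (mx_norm_le_enorm _)).
Qed.

(** The sup norm and the Euclidean norm are equivalent up to the factor [n], so limits may be tested
    with [enorm]. *)
Lemma cvg_enormP {T : Type} {G : set_system T} {FG : Filter G}
    (u : T -> 'cV[R]_n) p :
  u @ G --> p <-> forall e, 0 < e -> \forall k \near G, enorm (u k - p) < e.
Proof.
split=> [/cvgrPdist_lt up e e0|up]; last first.
  apply/cvgrPdist_lt => e /up; apply: filterS => k; apply: le_lt_trans.
  by rewrite distrC mx_norm_le_enorm.
(* Adding 1 keeps the divisor positive in dimension 0. *)
have n0 : 0 < n%:R + 1 :> R by rewrite ltr_wpDl.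
have := up _ (divr_gt0 e0 n0); apply: filterS => k.
rewrite distrC ltr_pdivlMr// mulrC; apply: le_lt_trans.
apply: le_trans (enorm_le_mx_norm _) _.
by rewrite ler_wpM2r// lerDl.
Qed.

(** Continuity in the matrix norm becomes a bound on the action, with one neighbourhood valid for
    every vector [v]. *)
Lemma hessian_near (f : 'cV[R]_n -> R) p eta : {for p, continuous (hessian f)} ->
  0 < eta -> \forall y \near p,
    forall v, enorm ((hessian f y - hessian f p) *m v) <= eta * enorm v.
Proof.
move=> /cvgrPdist_lt cf eta0.
have n0 : 0 < n%:R * n%:R + 1 :> R by rewrite ltr_wpDl// mulr_ge0.
have := cf _ (divr_gt0 eta0 n0); apply: filterS => y.
rewrite distrC ltr_pdivlMr// mulrC => /ltW yp v.
apply: le_trans (enorm_mulmx_mx_norm _ v) _; rewrite ler_wpM2r ?enorm_ge0// mulrA.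
by apply: le_trans yp; rewrite ler_wpM2r// lerDl.
Qed.

End Topology.

(** * Sequences with contracting steps: convergence and rate *)

Section Steps.
Context {R : realType} {n : nat}.
Context (x d : nat -> 'cV[R]_n).

Lemma steps_dist_le q K : q < 1 ->
  (forall k, (K <= k)%N -> x k.+1 = x k + d k) ->
  (forall k, (K <= k)%N -> enorm (d k.+1) <= q * enorm (d k)) ->
  forall k j, (K <= k)%N -> enorm (x (k + j)%N - x k) <= enorm (d k) / (1 - q).
Proof.
move=> q1 xS dS k j Kk; rewrite ler_pdivlMr ?subr_gt0//.
(* Contraction makes [‖d i‖ (1 - q) <= ‖d i‖ - ‖d i.+1‖], which telescopes. *)
suff : enorm (x (k + j)%N - x k) * (1 - q) <= enorm (d k) - enorm (d (k + j)%N).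
  by move/le_trans; apply; rewrite lerBlDr lerDl enorm_ge0.
elim: j => [|j IH]; first by rewrite addn0 !subrr enorm0 mul0r.
have Kkj : (K <= k + j)%N by rewrite (leq_trans Kk)// leq_addr.
rewrite addnS xS// addrAC.
have := enormD (x (k + j)%N - x k) (d (k + j)%N); have := dS _ Kkj.
nra.
Qed.

Lemma steps_norm_cvg0 q K : 0 <= q < 1 ->
  (forall k, (K <= k)%N -> enorm (d k.+1) <= q * enorm (d k)) ->
  (fun k => enorm (d k)) @ \oo --> (0 : R).
Proof.
move=> /andP[q0 q1] dS; rewrite -(cvg_shiftn K).
have dq j : enorm (d (j + K)%N) <= geometric (enorm (d K)) q j.
  elim: j => [|j IH] /=; first by rewrite add0n expr0 mulr1.
  rewrite addSn (le_trans (dS _ _)) ?leq_addl// exprS mulrCA.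
  by rewrite ler_wpM2l.
apply: (@squeeze_cvgr _ _ _ _ (fun=> 0) (geometric (enorm (d K)) q)).
- by near=> k; rewrite enorm_ge0 dq.
- exact: cvg_cst.
- by apply: cvg_geometric; rewrite ger0_norm.
Unshelve. all: by end_near. Qed.

Lemma steps_is_cvg q K : 0 <= q < 1 ->
  (forall k, (K <= k)%N -> x k.+1 = x k + d k) ->
  (forall k, (K <= k)%N -> enorm (d k.+1) <= q * enorm (d k)) ->
  cvgn x.
Proof.
move=> q01 xS dS; have /andP[q0 q1] := q01.
apply: cauchy_cvg; apply: cauchy_exP => e e0.
(* The tail beyond [M] has diameter controlled by [|d M| / (1 - q)], hence the factor [1 - q] in the
   threshold. *)
have e1 : 0 < e * (1 - q) by rewrite mulr_gt0// subr_gt0.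
have /cvgrPdist_lt/(_ _ e1)[N _ hN] := steps_norm_cvg0 q01 dS.
pose M := maxn N K; exists (x M).
exists M => // k /= Mk; rewrite -ball_normE/=.
apply: le_lt_trans (mx_norm_le_enorm _) _; rewrite enormB.
have KM : (K <= M)%N by rewrite leq_maxr.
rewrite -(subnKC Mk); apply: le_lt_trans (steps_dist_le q1 xS dS _ KM) _.
rewrite ltr_pdivrMr ?subr_gt0//.
have := hN M (leq_maxl N K); rewrite sub0r normrN; exact/le_lt_trans/ler_norm.
Qed.

Lemma steps_dist_lim_le q K (xs : 'cV[R]_n) : q < 1 ->
  (forall k, (K <= k)%N -> x k.+1 = x k + d k) ->
  (forall k, (K <= k)%N -> enorm (d k.+1) <= q * enorm (d k)) ->
  x @ \oo --> xs ->
  forall k, (K <= k)%N -> enorm (x k - xs) <= enorm (d k) / (1 - q).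
Proof.
move=> q1 xS dS /cvg_enormP xxs k Kk; apply/ler_addgt0Pr => e /xxs[N _ hN].
apply: le_trans (enorm_triangle _ (x (k + N)%N) _) _.
rewrite enormB lerD// ?(steps_dist_le q1 xS dS)//.
by apply/ltW/hN => /=; rewrite leq_addl.
Qed.

(** With [u] and [v] the new and old errors, [(1 - q) u <= |d k.+1| <= q |d k| <= q (u + v)], so
    [u <= q / (1 - 2 q) * v] with [q] arbitrarily small. *)
Lemma steps_superlinear K (xs : 'cV[R]_n) :
  (forall k, (K <= k)%N -> x k.+1 = x k + d k) ->
  (forall e, 0 < e -> \forall k \near \oo, enorm (d k.+1) <= e * enorm (d k)) ->
  x @ \oo --> xs ->
  (fun k => enorm (x k.+1 - xs) / enorm (x k - xs)) @ \oo --> (0 : R).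
Proof.
move=> xS dS xxs; apply/cvgrPdist_le => e e0.
(* [q <= 1/4] makes [q / (1 - 2 q) <= 2 q], and [q <= e / 2] makes this at most [e]. *)
pose q := Num.min (e / 2) 4^-1.
have q0 : 0 < q by rewrite lt_min; apply/andP; split; lra.
have q4 : q <= 4^-1 by rewrite ge_min lexx orbT.
have qe : q <= e / 2 by rewrite ge_min lexx.
have q1 : q < 1 by lra.
have [N _ hN] := dS _ q0; pose M := maxn N K.
have xS' k : (M <= k)%N -> x k.+1 = x k + d k.
  by move=> Mk; apply: xS; rewrite (leq_trans _ Mk)// leq_maxr.
have dS' k : (M <= k)%N -> enorm (d k.+1) <= q * enorm (d k).
  by move=> Mk; apply: hN; rewrite /= (leq_trans _ Mk)// leq_maxl.
exists M => // k /= Mk; rewrite sub0r normrN ger0_norm ?divr_ge0 ?enorm_ge0//.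
(* If [x k] already equals the limit, the quotient is 0 because the inverse of 0 is 0. *)
have [/enorm_le0 ->|xk0] := leP (enorm (x k - xs)) 0.
  by rewrite enorm0 invr0 mulr0 ltW.
rewrite ler_pdivrMr//.
have := steps_dist_lim_le q1 xS' dS' xxs (leqW Mk).
rewrite ler_pdivlMr ?subr_gt0//.
have : enorm (d k) <= enorm (x k.+1 - xs) + enorm (x k - xs).
  rewrite (enormB (x k)) (le_trans _ (enormD _ _))// addrA subrK xS'//.
  by rewrite [x k + _]addrC addrK.
have := dS' k Mk; have := enorm_ge0 (x k.+1 - xs).
nra.
Qed.

End Steps.

(** * Aggregated objectives: step estimates and criticality of limits *)

Section Aggregate.
Context {R : realType} {m n : nat}.
Context (F : 'I_m -> 'cV[R]_n -> R).
Implicit Types (l mu : 'cV[R]_m) (x d : 'cV[R]_n) (B : 'M[R]_n) (a b c e sigma : R).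

Lemma dotv_agg_gradient_lt0 l x d : simplex l ->
  (forall i, dotv (gradient (F i) x) d < 0) -> dotv (agg_gradient F l x) d < 0.
Proof.
move=> [l1 l0] Fd; rewrite dotvC /agg_gradient dotv_sumr.
under eq_bigr do rewrite dotvZr dotvC.
rewrite lt_neqAle sumr_le0 ?andbT => [|i _]; last first.
  by rewrite mulr_ge0_le0// ltW.
apply/negP => /eqP s0.
(* A vanishing sum of nonpositive terms vanishes termwise, and each slope is nonzero, so all weights
   would be 0. *)
suff : \sum_i l i 0 = 0 by apply/eqP; rewrite l1 oner_eq0.
apply: big1 => i _; apply/eqP.
have /eqP : \sum_i - (l i 0 * dotv (gradient (F i) x) d) = 0.
  by rewrite sumrN s0 oppr0.
rewrite psumr_eq0 => [/allP/(_ i)|j _]; last first.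
  by rewrite oppr_ge0 mulr_ge0_le0// ltW.
by rewrite mem_index_enum oppr_eq0 mulf_eq0 (lt_eqF (Fd i)) orbF; apply.
Qed.

Section SecondOrder.
Context (hF : forall i, twice_continuously_differentiable (F i)).
Context (l : 'cV[R]_m) (x d : 'cV[R]_n) (c : R) (hl : simplex l).
Context (hc : forall i t, 0 < t < 1 ->
  enorm ((hessian (F i) (x + t *: d) - hessian (F i) x) *m d) <= c).

Lemma agg_gradient_mean_value :
  enorm (agg_gradient F l (x + d) - agg_gradient F l x - agg_hessian F l x *m d)
    <= c.
Proof.
rewrite /agg_gradient /agg_hessian mulmx_suml -!sumrB.
under eq_bigr do rewrite -scalemxAl -!scalerBr.
apply: enorm_simplex_sum => // i; have [_ gd _] := hF i.
by apply: gradient_mean_value => // t; exact: hc.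
Qed.

Lemma agg_taylor2_le :
  agg F l (x + d) - agg F l x <= dotv (agg_gradient F l x) d
    + 2^-1 * (dotv d (agg_hessian F l x *m d) + c * enorm d).
Proof.
have [l1 l0] := hl.
have -> : c = \sum_i l i 0 * c by rewrite -big_distrl/= l1 mul1r.
rewrite dotvC /agg_gradient /agg_hessian mulmx_suml !dotv_sumr big_distrl/=.
rewrite -big_split/= big_distrr/= -big_split/= /agg -sumrB.
apply: ler_sum => i _; have [fd gd _] := hF i.
rewrite -scalemxAl !dotvZr [dotv d (gradient _ _)]dotvC.
have := ler_wpM2l (l0 i) (taylor2_le fd gd (hc i)).
by rewrite !mulrDr mulrN !mulrA ![2^-1 * _]mulrC.
Qed.

End SecondOrder.

(** As [B d] cancels the gradient at [x], the new gradient is the quasi-Newton error [-(B - H) d]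
    plus the mean value remainder. *)
Lemma agg_gradient_step_le l x d B c e :
  (forall i, twice_continuously_differentiable (F i)) -> simplex l ->
  (forall i t, 0 < t < 1 ->
    enorm ((hessian (F i) (x + t *: d) - hessian (F i) x) *m d) <= c) ->
  B *m d = - agg_gradient F l x ->
  enorm ((B - agg_hessian F l x) *m d) <= e ->
  enorm (agg_gradient F l (x + d)) <= e + c.
Proof.
move=> hF hl hc Bd he; have mv := agg_gradient_mean_value hF hl hc.
have -> : agg_gradient F l (x + d) = - ((B - agg_hessian F l x) *m d) +
    (agg_gradient F l (x + d) - agg_gradient F l x - agg_hessian F l x *m d).
  by rewrite mulmxBl Bd opprB opprK [RHS]addrC addrA !subrK.
by rewrite (le_trans (enormD _ _))// enormN lerD.
Qed.

(** Taylor bounds the change by [- d.Bd / 2 + c |d|^2]; it remains that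
    [2 c |d|^2 <= (1 - sigma) d.Bd], which follows from [a |d|^2 <= d.Bd]. *)
Lemma armijo_unit_step l x d B a c sigma :
  (forall i, twice_continuously_differentiable (F i)) -> simplex l ->
  (forall i t, 0 < t < 1 ->
    enorm ((hessian (F i) (x + t *: d) - hessian (F i) x) *m d) <= c * enorm d) ->
  B *m d = - agg_gradient F l x ->
  enorm ((agg_hessian F l x - B) *m d) <= c * enorm d ->
  0 < a -> loewner_le a%:M B -> sigma <= 1 -> 2 * c / a <= 1 - sigma ->
  armijo F sigma B l x d 1.
Proof.
move=> hF hl hc Bd hHB a0 aB sigma1 csigma.
have := agg_taylor2_le hF hl hc.
rewrite /armijo scale1r mulr1 /theta => /le_trans; apply.
have -> : dotv (agg_gradient F l x) d = - dotv d (B *m d).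
  by rewrite Bd dotvNr opprK dotvC.
have := dotv_le_enorm d ((agg_hessian F l x - B) *m d).
rewrite mulmxBl dotvBr -mulmxBl.
have := ler_wpM2l (enorm_ge0 d) hHB.
have aD := loewner_le_scalar_l d aB.
move: csigma; rewrite ler_pdivrMr// => csigma.
have : 2 * c * enorm d ^+ 2 <= (1 - sigma) * dotv d (B *m d).
  have s1 : 0 <= 1 - sigma by rewrite subr_ge0.
  apply: le_trans (ler_wpM2l s1 aD).
  by rewrite [leRHS]mulrA ler_wpM2r ?sqr_ge0.
nra.
Qed.

(** The dual value at [l] is [d.Bd / 2 >= a |d|^2 / 2], while the value at the competitor [mu] is at
    most [|g|^2 / (2 a)]. In the run, [mu] is the multiplier of the preceding iteration. *)
Lemma next_direction_le l mu x d B a :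
  0 < a -> loewner_le a%:M B -> d = - (invmx B *m agg_gradient F l x) ->
  dual_objective F B x l <= dual_objective F B x mu ->
  a * enorm d <= enorm (agg_gradient F mu x).
Proof.
move=> a0 aB dE; rewrite /dual_objective ler_pM2l ?invr_gt0// => lmu.
have Bd : B *m d = - agg_gradient F l x.
  by rewrite dE mulmxN mulKVmx// (loewner_unitmx a0 aB).
rewrite -ler_sqr ?nnegrE ?mulr_ge0 ?enorm_ge0 ?(ltW a0)//.
have := le_trans lmu (invmx_form_le (agg_gradient F mu x) a0 aB).
rewrite ler_pdivlMr//; apply: le_trans.
have -> : invmx B *m agg_gradient F l x = - d by rewrite dE opprK.
have := loewner_le_scalar_l d aB.
rewrite Bd !dotvNr dotvC => /(ler_wpM2l (ltW a0)).
by rewrite mulrA -expr2 -exprMn [X in _ -> _ <= X]mulrC.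
Qed.

(** A common descent direction [v] at the limit has slopes at most [- 2 c], hence below [- c] at
    nearby iterates, and so for every convex combination; this contradicts aggregated gradients
    tending to 0. No limit of the multipliers is taken. *)
Lemma pareto_critical_lim (x : nat -> 'cV[R]_n) (l : nat -> 'cV[R]_m) xs :
  (forall i, differentiable (gradient (F i)) xs) -> (forall k, simplex (l k)) ->
  x @ \oo --> xs -> agg_gradient F (l k) (x k) @[k --> \oo] --> (0 : 'cV[R]_n) ->
  pareto_critical F xs.
Proof.
move=> gd hl xxs /cvg_enormP g0 [v vlt0].
have [c [c0 cv]] : exists c : R,
    0 < c /\ forall i, 2 * c <= - dotv (gradient (F i) xs) v.
  (* Finitely many positive margins admit a common positive lower bound. *)
  have h : \forall c \near (0 : R)^'+,
      forall i, c <= - dotv (gradient (F i) xs) v.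
    by apply: filter_forall => i; apply: nbhs_right_le; rewrite oppr_gt0.
  have [c [c0 hc]] := filter_ex (filterI (nbhs_right_gt 0) h).
  exists (c / 2); split; first by rewrite divr_gt0.
  by move=> i; rewrite mulrC divfK.
have nv : 0 < enorm v + 1 by rewrite ltr_wpDl ?enorm_ge0.
have eta0 := divr_gt0 c0 nv.
have gF : \forall k \near \oo, forall i,
    enorm (gradient (F i) (x k) - gradient (F i) xs) < c / (enorm v + 1).
  apply: filter_forall => i.
  have /differentiable_continuous/(cvg_comp _ _ xxs) gx := gd i.
  by have /cvg_enormP/(_ _ eta0) := gx.
have [k [gFk gk]] := filter_ex (filterI gF (g0 _ eta0)).
have small w : enorm w < c / (enorm v + 1) -> `|dotv w v| < c.
  rewrite ltr_pdivlMr// => wc; rewrite ltr_norml.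
  have := dotv_le_enorm w v; have := dotv_le_enorm (- w) v; rewrite enormN dotvNl.
  have := enorm_ge0 w; have := enorm_ge0 v => ? ? ? ?.
  by apply/andP; split; nra.
move: gk; rewrite subr0 => /small; rewrite ltr_norml => /andP[+ _].
apply/negP; rewrite -leNgt.
have [l1 l0] := hl k.
rewrite dotvC /agg_gradient dotv_sumr.
have -> : - c = \sum_i l k i 0 * - c by rewrite -big_distrl/= l1 mul1r.
apply: ler_sum => i _; rewrite dotvZr ler_wpM2l// dotvC.
have := small _ (gFk i); have := cv i.
rewrite ltr_norml dotvDl dotvNl => h1 /andP[_ h2]; lra.
Qed.

End Aggregate.

(** * Contraction along the run, then criticality of the limit and rate *)

Theorem theorem4 (R : realType) (m n : nat) (F : 'I_m -> 'cV[R]_n -> R)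
    (sigma gamma : R)
    (x : nat -> 'cV[R]_n) (B : nat -> 'M[R]_n) (lam : nat -> 'cV[R]_m)
    (d : nat -> 'cV[R]_n) (alpha : nat -> R)
    (V : set 'cV[R]_n) (k0 : nat) (a b r delta eps : R)
    (hF : forall i, twice_continuously_differentiable (F i))
    (hsigma : 0 < sigma < 1) (hgamma : 0 < gamma < 1)
    (hrun : vmm_bfgs F sigma gamma x B lam d alpha)
    (hcrit : forall k, ~ pareto_critical F (x k))
    (hlim : (fun k => enorm ((B k - agg_hessian F (lam k) (x k)) *m d k)
                      / enorm (d k)) @ \oo --> (0 : R))
    (ha0 : 0 < a) (hb0 : 0 < b) (hr0 : 0 < r)
    (hdelta0 : 0 < delta) (heps0 : 0 < eps)
    (ha : forall k, loewner_le a%:M (B k) /\ loewner_le (B k) b%:M)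
    (hb : forall y z, V y -> V z -> enorm (y - z) < delta ->
       forall i, opnorm (hessian (F i) y - hessian (F i) z) < eps / 2)
    (hc : forall k, (k0 <= k)%N -> forall y, V y -> y <> x k ->
       enorm ((agg_hessian F (lam k) (x k) - B k) *m (y - x k))
         < eps / 2 * enorm (y - x k))
    (hd : eps / a <= 1 - sigma)
    (he : [set y | enorm (y - x k0) <= r] `<=` V)
    (hf : enorm (d k0) <= Num.min delta (r * (1 - eps / a))) :
  (forall k, (k0 <= k)%N ->
     [/\ enorm (x k - x k0)
           <= (1 - (eps / a) ^+ (k - k0)) / (1 - eps / a) * enorm (d k0),
         enorm (d k) <= (eps / a) ^+ (k - k0) * enorm (d k0),
         alpha k = 1
       & enorm (d k.+1) <= eps / a * enorm (d k)])
  /\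
  (exists xstar : 'cV[R]_n,
     [/\ x @ \oo --> xstar,
         pareto_critical F xstar
       & (fun k => enorm (x k.+1 - xstar) / enorm (x k - xstar)) @ \oo
           --> (0 : R)]).
Proof.
have [/andP[sigma0 sigma1] /andP[g0 g1]] := (hsigma, hgamma).
case: hrun => _ hlam hdir hstep hnext _.
set q := eps / a in hd hf *.
have q0 : 0 < q by rewrite divr_gt0.
have q1 : q < 1 by lra.
have [hfdelta hfr] : enorm (d k0) <= delta /\ enorm (d k0) <= r * (1 - q).
  by move: hf; rewrite le_min => /andP[].
have lamS k : simplex (lam k) by case: (hlam k).
have aB k : loewner_le a%:M (B k) by case: (ha k).
have Bd k : B k *m d k = - agg_gradient F (lam k) (x k).
  by rewrite hdir mulmxN mulKVmx// (loewner_unitmx ha0 (aB k)).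
(* A zero direction means a zero aggregated gradient, which excludes a common descent direction and
   makes [x k] critical. *)
have dneq0 k : d k != 0.
  apply/eqP => d0; apply: (hcrit k) => -[v /(dotv_agg_gradient_lt0 (lamS k))].
  have -> : agg_gradient F (lam k) (x k) = 0.
    by apply: oppr_inj; rewrite -Bd d0 mulmx0 oppr0.
  by rewrite dotvE big1 ?ltxx// => i _; rewrite mxE mul0r.
have dgt0 k := enorm_gt0 (dneq0 k).
(* Used twice: with [eps / 2] for both constants in the contraction, and with arbitrarily small
   constants for the rate. *)
have hessd k c : (forall i t, 0 < t < 1 ->
      enorm ((hessian (F i) (x k + t *: d k) - hessian (F i) (x k)) *m d k)
        <= c * enorm (d k)) ->
    x k.+1 = x k + d k ->
    forall e,
    enorm ((B k - agg_hessian F (lam k) (x k)) *m d k) <= e * enorm (d k) ->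
    a * enorm (d k.+1) <= (e + c) * enorm (d k).
  move=> hc' xS e he'.
  apply: (@le_trans _ _ (enorm (agg_gradient F (lam k) (x k.+1)))).
    apply: next_direction_le (hdir k.+1) _ => //.
    by have [_] := hlam k.+1; apply.
  by rewrite xS mulrDl; apply: agg_gradient_step_le.
have step k : (k0 <= k)%N -> enorm (x k - x k0) <= r ->
    enorm (x k + d k - x k0) <= r -> enorm (d k) <= delta ->
    alpha k = 1 /\ enorm (d k.+1) <= q * enorm (d k).
  move=> k0k xr xdr ddelta.
  have hessV i t : 0 < t < 1 ->
      enorm ((hessian (F i) (x k + t *: d k) - hessian (F i) (x k)) *m d k)
        <= eps / 2 * enorm (d k).
    move=> /andP[t0 t1]; apply: le_trans (enorm_mulmx_opnorm _ _) _.
    rewrite ler_wpM2r ?enorm_ge0//; apply/ltW/hb; try apply: he => //=.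
      apply: le_trans (enorm_segment_le _ _ _ _) _; first by rewrite !ltW.
      nra.
    (* The strict [t < 1] with [d k] nonzero gives a distance below [delta] even when
       [|d k| = delta]. *)
    rewrite addrAC subrr add0r enormZ gtr0_norm// (lt_le_trans _ ddelta)//.
    by rewrite gtr_pMl.
  have hBd : enorm ((agg_hessian F (lam k) (x k) - B k) *m d k)
      <= eps / 2 * enorm (d k).
    (* Condition (c) is taken at the trial point [y = x k + d k], distinct from [x k] since [d k] is
       nonzero. *)
    have dE : d k = x k + d k - x k by rewrite addrAC subrr add0r.
    rewrite {1 2}dE; apply/ltW/hc => //; first exact: he.
    by move=> /eqP; rewrite -subr_eq0 -dE; apply/negP.
  have a1 : alpha k = 1.
    (* A positive backtracking exponent would mean that the trial at exponent 0, the unit step, had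
       failed. *)
    have [[|j] [-> _ hj]] := hstep k; first by rewrite expr0.
    case: (hj 0%N) => //; rewrite expr0.
    apply: (@armijo_unit_step _ _ _ _ _ _ _ _ a (eps / 2)) => //; first exact: ltW.
    by rewrite [2 * _]mulrC divfK.
  split => //.
  have xS : x k.+1 = x k + d k by rewrite hnext a1 scale1r.
  have := hessd k _ hessV xS (eps / 2).
  rewrite -splitr -enormN -mulNmx opprB => /(_ hBd).
  by rewrite /q -mulrA [a^-1 * _]mulrC mulrA ler_pdivlMr// mulrC.
(* The claims go together: the distance bounds at [k] and at the next point keep both in the ball,
   which [step] requires, and [step] yields the bounds for the next index. *)
have ind j : let k := (k0 + j)%N in
    enorm (x k - x k0) <= (1 - q ^+ j) / (1 - q) * enorm (d k0) /\
    enorm (d k) <= q ^+ j * enorm (d k0) /\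
    alpha k = 1 /\ enorm (d k.+1) <= q * enorm (d k).
  (* Every partial geometric sum is at most [1 / (1 - q)], and (f) gives [|d k0| / (1 - q) <= r]. *)
  have bnd i : (1 - q ^+ i) / (1 - q) * enorm (d k0) <= r.
    rewrite mulrAC ler_pdivrMr ?subr_gt0//; apply: le_trans hfr.
    by rewrite ler_piMl ?enorm_ge0// gerBl exprn_ge0// ltW.
  have next i k : enorm (x k - x k0) <= (1 - q ^+ i) / (1 - q) * enorm (d k0) ->
      enorm (d k) <= q ^+ i * enorm (d k0) ->
      enorm (x k + d k - x k0) <= (1 - q ^+ i.+1) / (1 - q) * enorm (d k0).
    move=> h1 h2; rewrite addrAC; apply: le_trans (enormD _ _) _.
    have -> : (1 - q ^+ i.+1) / (1 - q) = (1 - q ^+ i) / (1 - q) + q ^+ i.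
      by rewrite exprS; field; rewrite subr_eq0 gt_eqF.
    by rewrite mulrDl lerD.
  elim: j => [|j [h1 [h2 [h3 h4]]]] k.
    have e0 : enorm (x k0 - x k0) <= (1 - q ^+ 0) / (1 - q) * enorm (d k0).
      by rewrite subrr enorm0 expr0 subrr !mul0r.
    have e1 : enorm (d k0) <= q ^+ 0 * enorm (d k0) by rewrite expr0 mul1r.
    rewrite /k addn0; do 2!split => //; apply: step => //.
      exact: le_trans e0 (bnd _).
    exact: le_trans (next _ _ e0 e1) (bnd _).
  have xS : x k = x (k0 + j)%N + d (k0 + j)%N.
    by rewrite /k addnS hnext h3 scale1r.
  have e0 : enorm (x k - x k0) <= (1 - q ^+ j.+1) / (1 - q) * enorm (d k0).
    by rewrite xS; apply: next.
  have e1 : enorm (d k) <= q ^+ j.+1 * enorm (d k0).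
    by rewrite /k addnS (le_trans h4)// exprS -mulrA ler_wpM2l// ltW.
  do 2!split => //; apply: step => //; first exact: leq_addr.
  - exact: le_trans e0 (bnd _).
  - exact: le_trans (next _ _ e0 e1) (bnd _).
  - apply: le_trans e1 _; apply: le_trans hfdelta.
    by rewrite ler_piMl ?enorm_ge0// exprn_ile1// ltW.
split.
  move=> k k0k; have [h1 [h2 [h3 h4]]] := ind (k - k0)%N.
  by move: h1 h2 h3 h4; rewrite subnKC.
have xS k : (k0 <= k)%N -> x k.+1 = x k + d k.
  move=> k0k; have [_ [_ [h3 _]]] := ind (k - k0)%N.
  by move: h3; rewrite subnKC// hnext => ->; rewrite scale1r.
have dS k : (k0 <= k)%N -> enorm (d k.+1) <= q * enorm (d k).
  by move=> k0k; have [_ [_ [_ h4]]] := ind (k - k0)%N; move: h4; rewrite subnKC.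
have q01 : 0 <= q < 1 by rewrite ltW.
have [xs xcvg] : exists xs : 'cV[R]_n, x @ \oo --> xs.
  by exists (lim (x @ \oo)); exact: steps_is_cvg q01 xS dS.
have d0 := steps_norm_cvg0 q01 dS.
exists xs; split => //.
  apply: pareto_critical_lim lamS xcvg _.
    by move=> i; have [_ gd _] := hF i.
  apply/cvg_enormP => e e0.
  (* The aggregated gradient is [- B d], of norm at most [b |d k|], so [|d k| < e / b] suffices. *)
  have /cvgrPdist_lt/(_ _ (divr_gt0 e0 hb0)) := d0; apply: filterS => k.
  rewrite sub0r normrN ger0_norm ?enorm_ge0// subr0 ltr_pdivlMr// mulrC.
  apply: le_lt_trans; rewrite -enormN -Bd.
  have [_ Bb] := ha k.
  apply: loewner_enorm_mulmx_le => //; first exact: ltW.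
  exact: loewner_psdmx (ltW ha0) _.
apply: (@steps_superlinear _ _ _ d k0) => // e e0.
(* Of the budget [a * e = 4 c], the Dennis-More error takes [2 c], and the Hessian variation takes
   [c] at each of two points compared with [xs]. *)
pose c := a * e / 4.
have c0 : 0 < c by rewrite divr_gt0 ?mulr_gt0.
have [rho rho0 hrho] : exists2 rho, 0 < rho & forall y, enorm (y - xs) < rho ->
    forall i v, enorm ((hessian (F i) y - hessian (F i) xs) *m v) <= c * enorm v.
  apply: nbhs_enorm.
  have h i : \forall y \near xs, forall v,
      enorm ((hessian (F i) y - hessian (F i) xs) *m v) <= c * enorm v.
    by apply: hessian_near => //; have [_ _] := hF i; apply.
  exact: filter_forall h.
have /cvg_enormP/(_ _ rho0) xrho := xcvg.
have xSrho : \forall k \near \oo, enorm (x k.+1 - xs) < rho.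
  by have := xcvg; rewrite -cvg_shiftS => /cvg_enormP/(_ _ rho0).
have c20 : 0 < 2 * c by rewrite mulr_gt0.
have /cvgrPdist_le/(_ _ c20) hlim' := hlim.
near=> k.
have k0k : (k0 <= k)%N by near: k; exists k0.
have hx : enorm (x k - xs) < rho by near: k.
have hxS : enorm (x k + d k - xs) < rho by rewrite -xS//; near: k.
have hBH : enorm ((B k - agg_hessian F (lam k) (x k)) *m d k)
    <= 2 * c * enorm (d k).
  rewrite -ler_pdivrMr// -[leLHS]ger0_norm ?divr_ge0 ?enorm_ge0//.
  by rewrite -normrN -sub0r; near: k.
suff hH i t : 0 < t < 1 ->
    enorm ((hessian (F i) (x k + t *: d k) - hessian (F i) (x k)) *m d k)
      <= 2 * c * enorm (d k).
  have := hessd k _ hH (xS _ k0k) _ hBH.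
  have -> : 2 * c + 2 * c = a * e by rewrite /c; field.
  by rewrite -mulrA ler_pM2l.
move=> /andP[t0 t1].
have -> : hessian (F i) (x k + t *: d k) - hessian (F i) (x k) =
    (hessian (F i) (x k + t *: d k) - hessian (F i) xs)
    - (hessian (F i) (x k) - hessian (F i) xs) by rewrite opprB addrA subrK.
rewrite mulmxBl; apply: le_trans (enormD _ _) _.
rewrite enormN -mulrA mulr_natl mulr2n lerD// ?hrho//.
apply: le_lt_trans (enorm_segment_le _ _ _ _) _; first by rewrite !ltW.
nra.
Unshelve. all: by end_near. Qed.
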